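(* Let $K$ be a finite extension of $K_0=\mathbb{F}_q(T)$. Let $\phi:A\to K\{\tau\}$ be a Drinfeld module of rank $r\geqslant 1$ defined over $K$. Let $v$ be a finite place of $K$. For any $G,H\in\mathtt{SG}_K(\phi)$, we have $$h_{\mathrm{Gr},K}^v\big(\phi/(G\cap H)\big)+h_{\mathrm{Gr},K}^v\big(\phi/(G+H)\big)\leqslant h_{\mathrm{Gr},K}^v(\phi/G)+h_{\mathrm{Gr},K}^v(\phi/H).$$
   Context: Notation. $\mathbb{F}_q$ is a finite field with $q$ elements, $A=\mathbb{F}_q[T]$, $K_0=\mathbb{F}_q(T)$, and $K/K_0$ is a finite field extension. $K\{\tau\}$ is the ring of twisted polynomials $\sum_i f_i\tau^i$ ($f_i\in K$) with $\tau c=c^q\tau$ for $c\in K$; to $f=\sum_{i=0}^d f_i\tau^i$ one associates the polynomial $f(x)=\sum_i f_i x^{q^i}\in K[x]$. $f$ is normalized if its constant coefficient $f_0$ is $1$, and, if $f_0\neq0$, $\ker(f)$ is the set of roots of $f(x)$ in $\overline K$. Drinfeld modules. A Drinfeld module of rank $r\geqslant1$ over $K$ is an $\mathbb{F}_q$-algebra homomorphism $\phi:A\to K\{\tau\}$, $a\mapsto\phi_a$, such that for every $a\in A$ the constant coefficient of $\phi_a$ is $a$, and $\deg_\tau\phi_a=r\deg_T a$. An isogeny $f:\phi\to\psi$ is a nonzero $f\in K\{\tau\}$ with $f\cdot\phi_a=\psi_a\cdot f$ for all $a\in A$. $\mathtt{SG}_K(\phi)$ is the set of finite dimensional $\mathbb{F}_q$-subspaces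 $G$ of the separable closure $K^{\mathrm{sep}}$ which are stable under $\mathrm{Gal}(K^{\mathrm{sep}}/K)$ and satisfy $\phi_a(G)\subseteq G$ for all $a\in A$; it is closed under intersection and sum. For $G\in\mathtt{SG}_K(\phi)$ there are a unique Drinfeld module $\phi/G$ over $K$ and a unique normalized isogeny $f_G:\phi\to\phi/G$ over $K$ with $\ker(f_G)=G$. Places. Each place $v$ of $K$ gives a valuation $\mathrm{ord}_v:K\to\mathbb{Z}\cup\{\infty\}$ normalized by $\mathrm{ord}_v(K^* )=\mathbb{Z}$. A place of $K$ is infinite if it lies above the place $\infty$ of $K_0$ (given by $\mathrm{ord}_\infty(a)=-\deg a$ for $a\in A$), and finite otherwise. Local graded height. For a Drinfeld module $\phi$ of rank $r$ over $K$, with $\phi_T=T+g_1\tau+\dots+g_r\tau^r$, $$h_{\mathrm{Gr},K}^v(\phi)=-\min\Big\{\frac{\mathrm{ord}_v(g_i)}{q^i-1}:1\leqslant i\leqslant r\Big\}\in\mathbb{Q}.$$ *)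

(* Defs.v *)
From HB Require Import structures.
From mathcomp Require Import all_boot all_order all_fingroup all_algebra.
From mathcomp Require Import all_solvable all_field.
From mathcomp Require Import classical_sets.

Set Implicit Arguments.
Unset Strict Implicit.
Unset Printing Implicit Defensive.

Import Order.TTheory GRing.Theory Num.Theory.
Local Open Scope classical_set_scope.
Local Open Scope ring_scope.

Section TwistedPolynomials.
Variables (F : finFieldType) (K : fieldExtType {fraction {poly F}}).
Local Notation q := #|F|.

(* The inclusions in K of A = F[T], with T = 'X, and of F. *)
Definition polyK (a : {poly F}) : K := (FracField.tofrac a)%:A.
Definition constK (c : F) : K := polyK c%:P.

Fact polyK_is_zmod_morphism : zmod_morphism polyK.
Proof. by move=> a b; rewrite /polyK rmorphB scalerBl. Qed.
Fact polyK_is_monoid_morphism : monoid_morphism polyK.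
Proof.
by split=> [|a b]; rewrite /polyK ?rmorph1 ?scale1r // rmorphM mulr_algl scalerA.
Qed.
HB.instance Definition _ := GRing.isZmodMorphism.Build {poly F} K polyK
  polyK_is_zmod_morphism.
HB.instance Definition _ := GRing.isMonoidMorphism.Build {poly F} K polyK
  polyK_is_monoid_morphism.
HB.instance Definition _ :=
  GRing.RMorphism.copy constK (polyK \o @polyC F).

Fact pchar_pnat_cardX i : [pchar K].-nat (q ^ i)%N.
Proof.
have [p pr_p pF] := finPcharP F.
have pK : p \in [pchar K] by apply: (rmorph_pchar constK).
rewrite (eq_pnat _ (pcharf_eq pK)) pnatX -cardsT; apply/orP; left.
exact: abelem_pgroup (fin_ring_pchar_abelem pF).
Qed.

Fact exprDn_card i (x y : K) :
  (x + y) ^+ (q ^ i) = x ^+ (q ^ i) + y ^+ (q ^ i).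
Proof. exact/exprDn_pchar/pchar_pnat_cardX. Qed.

Fact expr0n_card i : (0 : K) ^+ (q ^ i) = 0.
Proof. by rewrite expr0n expn_eq0 (gtn_eqF (ltnW (finNzRing_gt1 F))). Qed.

Fact expr_sum_card i (I : Type) (r : seq I) (f : I -> K) :
  (\sum_(j <- r) f j) ^+ (q ^ i) = \sum_(j <- r) f j ^+ (q ^ i).
Proof.
elim/big_rec2: _ => [|j x y _ <-]; first exact: expr0n_card.
exact: exprDn_card.
Qed.

Fact constK_expr_card i (c : F) : constK c ^+ (q ^ i) = constK c.
Proof.
elim: i => [|i IHi]; first by rewrite expn0 expr1.
by rewrite expnSr exprM IHi -rmorphXn expf_card.
Qed.

(* The ring K{tau}: f = \sum_i f_i tau^i is stored as the polynomial with
   coefficients f`_i = f_i, and only the product differs from that of {poly K};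
   deg_tau f is (size f).-1 when f != 0. *)
Definition twisted : Type := {poly K}.

HB.instance Definition _ := GRing.Zmodule.on twisted.

Implicit Types f g h : twisted.

Definition tw1 : twisted := (1%:P : {poly K}).

(* (\sum_i f_i tau^i) (\sum_j g_j tau^j) = \sum_(i, j) f_i g_j^(q^i) tau^(i+j),
   the rule of multiplication forced by tau c = c^q tau. *)
Definition tw_mul f g : twisted :=
  \poly_(n < (size f + size g).-1)
     \sum_(i < n.+1) f`_i * g`_(n - i) ^+ (q ^ i).

Definition tw_scale (c : F) f : twisted := (constK c *: (f : {poly K})).

Fact coef_tw_mul f g n :
  (tw_mul f g)`_n = \sum_(i < n.+1) f`_i * g`_(n - i) ^+ (q ^ i).
Proof.
rewrite coef_poly ltn_predRL; case: leqP => // le_fg_n1.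
rewrite big1 // => i _; have [lf_i|lt_i_f] := leqP (size f) i.
  by rewrite nth_default ?mul0r.
rewrite [g`__]nth_default ?expr0n_card ?mulr0 // leq_subRL -ltnS //.
by rewrite (leq_trans _ le_fg_n1) // ltn_add2r.
Qed.

Fact coef_tw_mul_rev f g n :
  (tw_mul f g)`_n = \sum_(i < n.+1) f`_(n - i) * g`_i ^+ (q ^ (n - i)).
Proof.
rewrite coef_tw_mul (reindex_inj rev_ord_inj) /=.
by apply: eq_bigr => j _; rewrite (sub_ordK j) subSS.
Qed.

Fact tw_mulA : associative tw_mul.
Proof.
move=> f g h; apply/polyP=> i; rewrite coef_tw_mul coef_tw_mul_rev.
pose coef3 j k :=
  f`_j * (g`_(i - j - k) * h`_k ^+ (q ^ (i - j - k))) ^+ (q ^ j).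
transitivity (\sum_(j < i.+1) \sum_(k < i.+1 | (k <= i - j)%N) coef3 j k).
  apply: eq_bigr => /= j _; rewrite coef_tw_mul_rev expr_sum_card big_distrr /=.
  by rewrite (big_ord_narrow_leq (leq_subr _ _)).
rewrite (exchange_big_dep predT) //=; apply: eq_bigr => k _.
transitivity (\sum_(j < i.+1 | (j <= i - k)%N) coef3 j k).
  apply: eq_bigl => j; rewrite -ltnS -(ltnS j) -!subSn ?leq_ord //.
  by rewrite -subn_gt0 -(subn_gt0 j) -!subnDA addnC.
rewrite (big_ord_narrow_leq (leq_subr _ _)) coef_tw_mul big_distrl /=.
apply: eq_bigr => j _; rewrite /coef3 exprMn -exprM -expnD subnAC subnK.
  by rewrite mulrA.
by rewrite -ltnS ltn_ord.
Qed.

Fact tw_mul1l : left_id tw1 tw_mul.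
Proof.
move=> f; apply/polyP => i; rewrite coef_tw_mul big_ord_recl subn0.
rewrite big1 => [|j _]; rewrite coefC /= ?mul0r //.
by rewrite expn0 expr1 mul1r addr0.
Qed.

Fact tw_mul1r : right_id tw1 tw_mul.
Proof.
move=> f; apply/polyP => i; rewrite coef_tw_mul_rev big_ord_recl subn0.
rewrite big1 => [|j _]; rewrite coefC /= ?expr0n_card ?mulr0 //.
by rewrite expr1n mulr1 addr0.
Qed.

Fact tw_mulDl : left_distributive tw_mul +%R.
Proof.
move=> f g h; apply/polyP=> i.
rewrite [RHS]coefD !coef_tw_mul -big_split /=.
by apply: eq_bigr => j _; rewrite coefD mulrDl.
Qed.

Fact tw_mulDr : right_distributive tw_mul +%R.
Proof.
move=> f g h; apply/polyP=> i.
rewrite [RHS]coefD !coef_tw_mul -big_split /=.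
by apply: eq_bigr => j _; rewrite coefD exprDn_card mulrDr.
Qed.

Fact tw1_neq0 : tw1 != 0.
Proof. exact: poly1_neq0. Qed.

HB.instance Definition _ := GRing.Zmodule_isNzRing.Build twisted
  tw_mulA tw_mul1l tw_mul1r tw_mulDl tw_mulDr tw1_neq0.

Fact tw_scaleA a b f : tw_scale a (tw_scale b f) = tw_scale (a * b) f.
Proof. by rewrite /tw_scale scalerA -rmorphM. Qed.
Fact tw_scale1 : left_id 1 tw_scale.
Proof. by move=> f; rewrite /tw_scale rmorph1 scale1r. Qed.
Fact tw_scaleDr : right_distributive tw_scale +%R.
Proof. by move=> c f g; rewrite /tw_scale -scalerDr. Qed.
Fact tw_scaleDl f : {morph tw_scale^~ f : a b / a + b}.
Proof. by move=> a b; rewrite /tw_scale rmorphD scalerDl. Qed.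
HB.instance Definition _ := GRing.Zmodule_isLmodule.Build F twisted
  tw_scaleA tw_scale1 tw_scaleDr tw_scaleDl.

Fact tw_scaleAl (c : F) f g : c *: (f * g) = (c *: f) * g.
Proof.
apply/polyP=> n; rewrite [LHS]coefZ [RHS]coef_tw_mul coef_tw_mul big_distrr /=.
by apply: eq_bigr => i _; rewrite coefZ mulrA.
Qed.
HB.instance Definition _ := GRing.Lmodule_isLalgebra.Build F twisted tw_scaleAl.

Fact tw_scaleAr (c : F) f g : c *: (f * g) = f * (c *: g).
Proof.
apply/polyP=> n; rewrite [LHS]coefZ [RHS]coef_tw_mul coef_tw_mul big_distrr /=.
by apply: eq_bigr => i _; rewrite coefZ exprMn constK_expr_card mulrCA.
Qed.
HB.instance Definition _ := GRing.Lalgebra_isAlgebra.Build F twisted tw_scaleAr.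

(* The F-linear polynomial f(x) = \sum_i f_i x^(q^i). *)
Definition tw_poly f : {poly K} := \sum_(i < size f) f`_i *: 'X^(q ^ i).

Definition tw_normalized f : Prop := f`_0 = 1.

Record drinfeld_module := DrinfeldModule {
  drinfeld_map :> {lrmorphism {poly F} -> twisted};
  drinfeld_rank : nat;
  drinfeld_rank_gt0 : (0 < drinfeld_rank)%N;
  drinfeld_coef0 : forall a : {poly F}, (drinfeld_map a)`_0 = polyK a;
  (* for a = 0 both degrees are -oo, as drinfeld_map 0 = 0 *)
  drinfeld_deg : forall a : {poly F}, a != 0 ->
    (size (drinfeld_map a)).-1 = (drinfeld_rank * (size a).-1)%N }.

Definition isogeny f (phi psi : drinfeld_module) : Prop :=
  f != 0 /\ forall a : {poly F}, f * phi a = psi a * f.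

(* A place of K is given by its normalized valuation. The value ord v 0 is
   meaningless: the convention ord_v(0) = +oo is enforced wherever it matters
   by considering nonzero elements only. *)
Record place := Place {
  ord : K -> int;
  ordM : forall x y, x != 0 -> y != 0 -> ord (x * y) = ord x + ord y;
  ordD : forall x y, x != 0 -> y != 0 -> x + y != 0 ->
    Num.min (ord x) (ord y) <= ord (x + y);
  ord_surj : forall n : int, exists2 x, x != 0 & ord x = n }.

(* v lies above the place oo of F(T): on F(T), ord_v is a positive multiple of
   ord_oo, which is determined by its values ord_oo(a) = - deg a on A. *)
Definition infinite_place (v : place) : Prop :=
  exists2 e : int, 0 < e & forall a : {poly F}, a != 0 ->
    ord v (polyK a) = e * - ((size a).-1)%:Z.

Definition finite_place (v : place) : Prop := ~ infinite_place v.

(* The minimum runs over the i with g_i != 0, the others having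
   ord_v(g_i) = +oo; it is seeded with the term i = r, for which g_r != 0. *)
Definition graded_height (v : place) (phi : drinfeld_module) : rat :=
  let r := drinfeld_rank phi in
  let slope i := (ord v (phi 'X)`_i)%:~R / (q ^ i - 1)%N%:R in
  - \big[Num.min/slope r]_(1 <= i < r.+1 | (phi 'X)`_i != 0) slope i.

End TwistedPolynomials.

Section TorsionSubspaces.
Variables (F : finFieldType) (K : fieldExtType {fraction {poly F}}).
(* In applications Kbar is an algebraic closure of K, embedded by iota. *)
Variables (Kbar : closedFieldType) (iota : {rmorphism K -> Kbar}).
Implicit Types (f : twisted K) (G : set Kbar).

Definition Ksep : set Kbar :=
  [set x | exists2 p : {poly K}, separable_poly p & root (map_poly iota p) x].

(* s restricts to an element of Gal(Ksep/K); its values outside Ksep are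
   irrelevant. *)
Record Gal_sep (s : Kbar -> Kbar) : Prop := GalSep {
  gal_onto : s @` Ksep = Ksep;
  gal_add : forall x y, Ksep x -> Ksep y -> s (x + y) = s x + s y;
  gal_mul : forall x y, Ksep x -> Ksep y -> s (x * y) = s x * s y;
  gal_fix : forall a : K, s (iota a) = iota a }.

Definition tw_eval f (x : Kbar) : Kbar := (map_poly iota (tw_poly f)).[x].

Definition tw_ker f : set Kbar := [set x | root (map_poly iota (tw_poly f)) x].

Record SG (phi : drinfeld_module K) G : Prop := IsSG {
  SG_sep : G `<=` Ksep;
  SG_0 : G 0;
  SG_add : forall x y, G x -> G y -> G (x + y);
  SG_scale : forall (c : F) x, G x -> G (iota (constK K c) * x);
  SG_fin : exists (n : nat) (b : 'I_n -> Kbar), forall x, G x ->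
    exists c : 'I_n -> F, x = \sum_i iota (constK K (c i)) * b i;
  SG_gal : forall s, Gal_sep s -> forall x, G x -> G (s x);
  SG_stable : forall (a : {poly F}) x, G x -> G (tw_eval (phi a) x) }.

Definition set_sum G H : set Kbar := [set x + y | x in G & y in H].

(* psi is phi/G: it is the target of the normalized isogeny f_G. *)
Definition is_quotient (phi : drinfeld_module K) G (psi : drinfeld_module K) :
    Prop :=
  exists f, [/\ isogeny f phi psi, tw_normalized f & tw_ker f = G].

End TorsionSubspaces.

(* Main.v *)
(* Let h be the height of phi and w(P) = min_i (ord_v(P_i) + i h), the Gauss
   valuation of P in K[x]. As v(T) >= 0, h is the only rational for which
   w(phi_T(x)) = h and this minimum is attained in degree > 1. For an isogeny
   f : phi -> psi, comparing the Gauss valuations of the two sides of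
   f phi_T = psi_T f, and the last degrees where they are attained, shows that
   psi has height w(f(x)).
   The union of G and H is contained in G + H, so the separable polynomials of
   these subspaces satisfy f_(G + H) f_(G cap H) = Q f_G f_H with Q in K[x];
   normalization gives Q(0) = 1, hence w(Q) <= 0. Conclude by multiplicativity
   of w. *)
Require Import Defs.
From mathcomp Require Import all_boot all_order all_algebra all_field.
From mathcomp Require Import classical_sets.
From mathcomp Require Import ring lra zify.
Set Implicit Arguments.
Unset Strict Implicit.
Unset Printing Implicit Defensive.
Import Order.TTheory GRing.Theory Num.Theory.
Local Open Scope classical_set_scope.
Local Open Scope ring_scope.

(** * Orders at a place and the ultrametric inequality *)

Section Valuation.
Variables (F : finFieldType) (K : fieldExtType {fraction {poly F}}).
Variable v : place K.
Implicit Types (x y : K) (m : rat).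

Lemma ord1 : ord v 1 = 0.
Proof.
have := ordM v (oner_neq0 K) (oner_neq0 K).
by rewrite mulr1 -{1}[ord v 1]addr0 => /addrI.
Qed.

Lemma ordX x n : x != 0 -> ord v (x ^+ n) = n%:Z * ord v x.
Proof.
move=> x0; elim: n => [|n IHn]; first by rewrite expr0 ord1 mul0r.
by rewrite exprS ordM ?expf_neq0 // IHn; lia.
Qed.

(** Applied to [-1] and to the nonzero constants of [F], which are all roots of unity. *)
Lemma ord_unity_root x n : (0 < n)%N -> x ^+ n = 1 -> ord v x = 0.
Proof.
move=> n0 xn1; have x0 : x != 0.
  apply/eqP=> x0; move/eqP: xn1.
  by rewrite x0 expr0n gtn_eqF // eq_sym oner_eq0.
by have := ordX n x0; rewrite xn1 ord1; nia.
Qed.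

Lemma ordN x : x != 0 -> ord v (- x) = ord v x.
Proof.
move=> x0; rewrite -mulN1r ordM ?oppr_eq0 ?oner_eq0 //.
by rewrite (@ord_unity_root (-1) 2) ?add0r // sqrrN expr1n.
Qed.

(* The value +oo is assigned to 0. *)
Definition ord_ge m x := (x == 0) || (m <= (ord v x)%:~R).
Definition ord_gt m x := (x == 0) || (m < (ord v x)%:~R).

Lemma ord_geD m x y : ord_ge m x -> ord_ge m y -> ord_ge m (x + y).
Proof.
rewrite /ord_ge; have [->|x0] /= := eqVneq x 0; first by rewrite add0r.
have [->|y0] /= := eqVneq y 0; first by rewrite addr0 (negbTE x0).
have [//|xy0] /= := eqVneq (x + y) 0 => mx my.
have := ordD v x0 y0 xy0; rewrite ge_min => /orP[] h.
  by apply: (le_trans mx); rewrite ler_int.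
by apply: (le_trans my); rewrite ler_int.
Qed.

Lemma ord_gtD m x y : ord_gt m x -> ord_gt m y -> ord_gt m (x + y).
Proof.
rewrite /ord_gt; have [->|x0] /= := eqVneq x 0; first by rewrite add0r.
have [->|y0] /= := eqVneq y 0; first by rewrite addr0 (negbTE x0).
have [//|xy0] /= := eqVneq (x + y) 0 => mx my.
have := ordD v x0 y0 xy0; rewrite ge_min => /orP[] h.
  by apply: (lt_le_trans mx); rewrite ler_int.
by apply: (lt_le_trans my); rewrite ler_int.
Qed.

Lemma ord_ge_sum m (I : Type) (r : seq I) (P : pred I) (E : I -> K) :
  (forall i, P i -> ord_ge m (E i)) -> ord_ge m (\sum_(i <- r | P i) E i).
Proof.
move=> hE; elim/big_ind: _ => //; first by rewrite /ord_ge eqxx.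
exact: ord_geD.
Qed.

Lemma ord_gt_sum m (I : Type) (r : seq I) (P : pred I) (E : I -> K) :
  (forall i, P i -> ord_gt m (E i)) -> ord_gt m (\sum_(i <- r | P i) E i).
Proof.
move=> hE; elim/big_ind: _ => //; first by rewrite /ord_gt eqxx.
exact: ord_gtD.
Qed.

(** If [x + y] had order above that of [x], or vanished, then so would [x = (x + y) - y], which is
    absurd. *)
Lemma ord_addl_dominant x y : x != 0 -> ord_gt (ord v x)%:~R y ->
  x + y != 0 /\ ord v (x + y) = ord v x.
Proof.
move=> x0 ltxy; have ltxNy : ord_gt (ord v x)%:~R (- y).
  by move: ltxy; rewrite /ord_gt oppr_eq0; case: eqVneq => //= y0; rewrite ordN.
have [xy0|xy0] := eqVneq (x + y) 0.
  move: ltxNy; have -> : - y = x by apply/eqP; rewrite eq_sym -addr_eq0 xy0.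
  by rewrite /ord_gt (negbTE x0) ltxx.
split=> //; apply/eqP; rewrite eq_le; apply/andP; split.
  rewrite leNgt; apply/negP=> lt_x_xy.
  have : ord_gt (ord v x)%:~R (x + y - y).
    by apply: ord_gtD => //; rewrite /ord_gt ltr_int lt_x_xy orbT.
  by rewrite addrK /ord_gt (negbTE x0) ltxx.
have : ord_ge (ord v x)%:~R (x + y).
  apply: ord_geD; first by rewrite /ord_ge lexx orbT.
  by move: ltxy; rewrite /ord_ge /ord_gt => /orP[->//|/ltW ->]; rewrite orbT.
by rewrite /ord_ge (negbTE xy0) ler_int.
Qed.

(** * Weighted Gauss valuations and their multiplicativity *)

(* The minimum of ord (a i) + wt i over a i != 0 is m, and d is the last index
   where it is attained. *)
Definition dominant (wt : nat -> rat) (a : nat -> K) m d :=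
  [/\ a d != 0, (ord v (a d))%:~R + wt d = m,
      forall i, a i != 0 -> m <= (ord v (a i))%:~R + wt i
    & forall i, (d < i)%N -> a i != 0 -> m < (ord v (a i))%:~R + wt i].

Lemma dominant_unique wt a m1 m2 d1 d2 :
  dominant wt a m1 d1 -> dominant wt a m2 d2 -> m1 = m2 /\ d1 = d2.
Proof.
move=> [a1 e1 le1 lt1] [a2 e2 le2 lt2]; have em : m1 = m2.
  by apply/eqP; rewrite eq_le -{1}e2 -{2}e1 le1 ?le2.
split=> //; case: (ltngtP d1 d2) => // hd.
  by have := lt1 _ hd a2; rewrite e2 em ltxx.
by have := lt2 _ hd a1; rewrite e1 em ltxx.
Qed.

Lemma dominant_exists wt (p : {poly K}) : p != 0 ->
  exists m d, dominant wt (fun i => p`_i) m d.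
Proof.
move=> p0; pose w i := (ord v p`_i)%:~R + wt i.
have lt_size i : p`_i != 0 -> (i < size p)%N.
  by apply: contraNltn => /leq_sizeP->.
have sz_gt0 : (0 < size p)%N by rewrite size_poly_gt0.
have lt_i0 : ((size p).-1 < size p)%N by rewrite ltn_predL.
have Pi0 : p`_(Ordinal lt_i0) != 0 by rewrite -lead_coefE lead_coef_eq0.
pose P := [pred i : 'I_(size p) | p`_i != 0].
case: (@Order.TotalTheory.arg_minP _ _ _ (Ordinal lt_i0) P (fun i => w i) Pi0).
move=> j /= pj minj.
(* Among the indices attaining the minimum, all below [size p], the largest is chosen. *)
have exd : exists i, (p`_i != 0) && (w i == w j) by exists j; rewrite pj eqxx.
have ubd i : (p`_i != 0) && (w i == w j) -> (i <= size p)%N.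
  by case/andP=> /lt_size/ltnW.
case: (ex_maxnP exd ubd) => d /andP[pd /eqP wd] maxd.
have lew i : p`_i != 0 -> w j <= w i.
  by move=> pi; apply: (minj (Ordinal (lt_size i pi))).
exists (w j), d; split=> // i di pi; rewrite lt_neqAle lew // andbT eq_sym.
by apply: contraTN di => wi; rewrite -leqNgt maxd // pi.
Qed.

(* Gauss's lemma, for the products of K[x] (e = 1) and of K{tau}
   (e i = q ^ i) at once. *)
Lemma dominant_mul wa wb wc (e : nat -> nat) (a b c : nat -> K) m mb da db :
    (forall i, (0 < e i)%N) ->
    (forall i j, wc (i + j)%N = wa i + (e i)%:R * wb j) ->
    (forall n, c n = \sum_(i < n.+1) a i * b (n - i)%N ^+ e i) ->
    dominant (fun i => wa i + (e i)%:R * mb) a m da -> dominant wb b mb db ->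
  dominant wc c m (da + db).
Proof.
move=> e_gt0 wcE cE [ada eda lea lta] [bdb edb leb ltb].
have e_gt0q i : 0 < (e i)%:R :> rat by rewrite ltr0n.
(* The weighted order of [b j ^+ e i] is at least [e i * mb]; this is the amount that the weight put
   on [a] already includes. *)
have ordT i j : a i != 0 -> b j != 0 ->
    (ord v (a i * b j ^+ e i))%:~R + wc (i + j)%N =
    (ord v (a i))%:~R + wa i + (e i)%:R * ((ord v (b j))%:~R + wb j).
  move=> ai bj; rewrite ordM ?expf_neq0 // ordX // wcE intrD intrM.
  by rewrite -pmulrn; ring.
have leT i j : ord_ge (m - wc (i + j)%N) (a i * b j ^+ e i).
  rewrite /ord_ge mulf_eq0 expf_eq0 e_gt0 /=.
  have [//|ai] := eqVneq (a i) 0; have [//|bj] := eqVneq (b j) 0 => /=.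
  rewrite lerBlDr ordT // (le_trans (lea _ ai)) // addrA lerD2l.
  by rewrite ler_pM2l // leb.
have ltT i j : (da < i)%N || (db < j)%N ->
    ord_gt (m - wc (i + j)%N) (a i * b j ^+ e i).
  move=> ij; rewrite /ord_gt mulf_eq0 expf_eq0 e_gt0 /=.
  have [//|ai] := eqVneq (a i) 0; have [//|bj] := eqVneq (b j) 0 => /=.
  rewrite ltrBlDr ordT //; case/orP: ij => [lt_i|lt_j].
    by rewrite (lt_le_trans (lta _ lt_i ai)) // addrA lerD2l ler_pM2l // leb.
  by rewrite (le_lt_trans (lea _ ai)) // addrA ltrD2l ltr_pM2l // ltb.
(* In degree [da + db], any index [i] other than [da] satisfies [da < i] or [db < da + db - i], so
   the term of index [da] strictly dominates. *)
have [cd0 ordcd] : c (da + db)%N != 0 /\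
    ord v (c (da + db)%N) = ord v (a da * b db ^+ e da).
  have lt_da : (da < (da + db).+1)%N by rewrite ltnS leq_addr.
  rewrite cE (bigD1 (Ordinal lt_da)) //= addKn.
  apply: ord_addl_dominant; first by rewrite mulf_neq0 ?expf_neq0.
  have -> : (ord v (a da * b db ^+ e da))%:~R = m - wc (da + db)%N.
    by apply/eqP; rewrite eq_sym subr_eq ordT // edb -addrA eda.
  apply: ord_gt_sum => i; rewrite -val_eqE /= => ne_i.
  have {1}-> : (da + db = i + (da + db - i))%N by rewrite subnKC // -ltnS.
  by apply: ltT; lia.
have shift n (i : 'I_n.+1) : n = (i + (n - i))%N by rewrite subnKC // -ltnS.
split=> //.
- by rewrite ordcd ordT // edb -addrA eda.
- move=> n cn0; have : ord_ge (m - wc n) (c n).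
    by rewrite cE; apply: ord_ge_sum => i _; rewrite {1}(shift _ i) leT.
  by rewrite /ord_ge (negbTE cn0) lerBlDr.
- move=> n lt_n cn0; have : ord_gt (m - wc n) (c n).
    rewrite cE; apply: ord_gt_sum => i _; rewrite {1}(shift _ i) ltT //.
    by lia.
  by rewrite /ord_gt (negbTE cn0) ltrBlDr.
Qed.

Lemma dominant_eq wt1 wt2 a m1 m2 d k : m2 = m1 + k ->
    (forall i, wt2 i = wt1 i + k) ->
  dominant wt1 a m1 d -> dominant wt2 a m2 d.
Proof.
move=> -> ewt [ad ed le lt]; split=> //.
- by rewrite ewt addrA ed.
- by move=> i ai; rewrite ewt addrA lerD2r le.
- by move=> i di ai; rewrite ewt addrA ltrD2r lt.
Qed.

Lemma dominant_poly_mul h (a b : {poly K}) ma mb da db :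
    dominant (fun i => i%:R * h) (fun i => a`_i) ma da ->
    dominant (fun i => i%:R * h) (fun i => b`_i) mb db ->
  dominant (fun i => i%:R * h) (fun i => (a * b)`_i) (ma + mb) (da + db).
Proof.
move=> Da Db; apply: dominant_mul (Db) => [i|i j|n|] /=.
- exact: (erefl : (0 < (fun=> 1%N) i)%N).
- by rewrite natrD mul1r mulrDl.
- by rewrite coefM; apply: eq_bigr => i _; rewrite expr1.
(* For [e = 1] the correction [e i * mb] is the constant [mb], which only shifts the minimum. *)
- by apply: dominant_eq Da => // i; rewrite mul1r.
Qed.

(** The product of K{tau} is composition: [g] sends the slope [h] to [mg], so [f] is measured with
    slope [mg] instead of [h]. *)
Lemma dominant_tw_mul h (f g : twisted K) mf mg df dg :
    dominant (fun i => (#|F| ^ i)%:R * mg) (fun i => f`_i) mf df ->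
    dominant (fun i => (#|F| ^ i)%:R * h) (fun i => g`_i) mg dg ->
  dominant (fun i => (#|F| ^ i)%:R * h) (fun i => (f * g)`_i) mf (df + dg).
Proof.
move=> Df Dg.
apply: (@dominant_mul (fun=> 0) _ _ (fun i => #|F| ^ i)%N) (Dg) => [i|i j|n|].
- by rewrite expn_gt0 (ltnW (finNzRing_gt1 F)).
- by rewrite add0r expnD natrM mulrA.
- exact: coef_tw_mul.
- by apply: (dominant_eq (k := 0)) Df => [|i] /=; rewrite ?add0r addr0.
Qed.

(** * From K{tau} to additive polynomials *)

Lemma coef_tw_poly_card (f : twisted K) i : (tw_poly f)`_(#|F| ^ i) = f`_i.
Proof.
rewrite /tw_poly coef_sum; have inj := expnI (finNzRing_gt1 F).
have [le_i|lt_i] := leqP (size f) i.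
  rewrite [RHS]nth_default // big1 // => j _.
  rewrite coefZ coefXn eqn_exp2l ?finNzRing_gt1 //.
  by rewrite gtn_eqF ?mulr0 // (leq_trans _ le_i).
rewrite (bigD1 (Ordinal lt_i)) //= coefZ coefXn eqxx mulr1 big1 ?addr0 // => j.
rewrite -val_eqE coefZ coefXn eqn_exp2l ?finNzRing_gt1 //= eq_sym => /negbTE ->.
by rewrite mulr0.
Qed.

Lemma coef_tw_poly_neq0 (f : twisted K) n :
  (tw_poly f)`_n != 0 -> exists2 i, n = (#|F| ^ i)%N & f`_i != 0.
Proof.
have [/existsP[i /eqP ->]|] := boolP [exists i : 'I_(size f), n == #|F| ^ i]%N.
  by rewrite coef_tw_poly_card; exists i.
rewrite negb_exists => /forallP ne_n; rewrite /tw_poly coef_sum big1 ?eqxx //.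
by move=> i _; rewrite coefZ coefXn (negbTE (ne_n i)) mulr0.
Qed.

(** Only the exponents q^i occur in f(x), so both minima run over the same terms, and the last index
    [d] becomes the degree q^d. *)
Lemma dominant_tw_poly h (f : twisted K) m d :
    dominant (fun i => (#|F| ^ i)%:R * h) (fun i => f`_i) m d ->
  dominant (fun i => i%:R * h) (fun i => (tw_poly f)`_i) m (#|F| ^ d).
Proof.
move=> [fd ed le lt]; split; rewrite ?coef_tw_poly_card //.
  by move=> n /coef_tw_poly_neq0[i -> fi]; rewrite coef_tw_poly_card le.
move=> n dn /coef_tw_poly_neq0[i n_i fi]; move: dn; rewrite n_i.
by rewrite ltn_exp2l ?finNzRing_gt1 // => di; rewrite coef_tw_poly_card lt.
Qed.

(** * Integrality of T at a finite place *)

Lemma polyK_neq0 (a : {poly F}) : a != 0 -> polyK K a != 0.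
Proof.
move=> a0; rewrite /polyK scaler_eq0 oner_eq0 orbF.
by rewrite tofrac_eq0.
Qed.

Lemma ord_constK (c : F) : c != 0 -> ord v (constK K c) = 0.
Proof.
move=> c0; have cK0 : constK K c != 0 by rewrite fmorph_eq0.
apply: (@ord_unity_root _ #|F|.-1); first by rewrite ltn_predRL finNzRing_gt1.
apply: (mulfI cK0); rewrite -exprS prednK ?mulr1 ?(ltnW (finNzRing_gt1 F)) //.
by have := constK_expr_card K 1 c; rewrite expn1.
Qed.

(** If T had negative order, the leading term of every nonzero [a] would strictly dominate, so that
    ord(a) = deg(a) ord(T), and [v] would be infinite with [e] equal to - ord(T). *)
Lemma finite_place_ordX : finite_place v -> 0 <= ord v (polyK K 'X).
Proof.
move=> v_fin; rewrite leNgt; apply/negP=> ordT_lt0; case: v_fin.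
exists (- ord v (polyK K 'X)); first by rewrite oppr_gt0.
move=> a a0; set t := polyK K 'X in ordT_lt0 *.
have t0 : t != 0 by rewrite polyK_neq0 // polyX_eq0.
have sza : (0 < size a)%N by rewrite size_poly_gt0.
have ordT c n : c != 0 -> ord v (constK K c * t ^+ n) = n%:Z * ord v t.
  by move=> c0; rewrite ordM ?fmorph_eq0 ?expf_neq0 // ord_constK // add0r ordX.
have -> : polyK K a = \sum_(i < size a) constK K a`_i * t ^+ i.
  rewrite -[a in LHS]coefK poly_def rmorph_sum; apply: eq_bigr => i _.
  by rewrite -mul_polyC rmorphM rmorphXn.
rewrite -(prednK sza) big_ord_recr /= addrC.
have lc0 : a`_(size a).-1 != 0 by rewrite -lead_coefE lead_coef_eq0.
have lt0 : constK K a`_(size a).-1 * t ^+ (size a).-1 != 0.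
  by rewrite mulf_neq0 ?fmorph_eq0 ?expf_neq0.
have [|_ ->] := @ord_addl_dominant _
  (\sum_(i < (size a).-1) constK K a`_i * t ^+ i) lt0; last first.
  by rewrite ordT // mulrNN mulrC.
apply: ord_gt_sum => i _; rewrite /ord_gt ordT //.
have [->|ai] := eqVneq a`_i 0; first by rewrite rmorph0 mul0r eqxx.
by rewrite ordT // ltr_int; apply/orP; right; have := ltn_ord i; nia.
Qed.

(** * The graded height as a fixed point of the Gauss valuation *)

Lemma drinfeld_size (phi : drinfeld_module K) :
  size (phi 'X) = (drinfeld_rank phi).+1.
Proof.
have X0 : ('X : {poly F}) != 0 by rewrite polyX_eq0.
have := drinfeld_deg phi X0; rewrite size_polyX muln1.
by case: (size _) (drinfeld_rank_gt0 phi) => [|n] /= lt_r e; lia.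
Qed.

Lemma graded_height_ge (phi : drinfeld_module K) i :
    (0 < i)%N -> (phi 'X)`_i != 0 ->
  - graded_height v phi <= (ord v (phi 'X)`_i)%:~R / (#|F| ^ i - 1)%N%:R.
Proof.
move=> i0 gi; rewrite /graded_height opprK.
apply: bigmin_inf_seq (lexx _) => //.
rewrite mem_index_iota i0 ltnS leqNgt; apply: contra gi => lt_i.
by rewrite nth_default // drinfeld_size.
Qed.

Lemma graded_height_attained (phi : drinfeld_module K) :
  exists2 i, (0 < i)%N && ((phi 'X)`_i != 0) &
    - graded_height v phi = (ord v (phi 'X)`_i)%:~R / (#|F| ^ i - 1)%N%:R.
Proof.
rewrite /graded_height opprK big_seq_cond.
elim/big_ind: _ => [|x y [i ci ->] [j cj ->]|i].
(* The seed of the minimum is the slope of the leading coefficient, hence a genuine term. *)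
- exists (drinfeld_rank phi) => //; rewrite drinfeld_rank_gt0 /=.
  have <- : (size (phi 'X)).-1 = drinfeld_rank phi by rewrite drinfeld_size.
  by rewrite -lead_coefE lead_coef_eq0 -size_poly_eq0 drinfeld_size.
- by case: leP => _; [exists i | exists j].
- rewrite mem_index_iota => /andP[/andP[i0 _] gi].
  by exists i => //; rewrite i0.
Qed.

Lemma card_expn_sub1 i :
  (#|F| ^ i - 1)%N%:R = (#|F| ^ i)%:R - 1 :> rat.
Proof. by rewrite natrB // expn_gt0 (ltnW (finNzRing_gt1 F)). Qed.

(** Clearing the denominator q^i - 1, positive since [0 < i], turns a bound on a slope into a bound
    on an order weighted by [m] itself. *)
Lemma slope_le (g m : rat) i : (0 < i)%N ->
  (- m <= g / (#|F| ^ i - 1)%N%:R) = (m <= g + (#|F| ^ i)%:R * m).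
Proof.
move=> i0; rewrite ler_pdivlMr ?card_expn_sub1; last first.
  by rewrite subr_gt0 ltr1n -(expn0 #|F|) ltn_exp2l ?finNzRing_gt1.
by apply/idP/idP; nra.
Qed.

Lemma slope_ge (g m : rat) i : (0 < i)%N ->
  (g / (#|F| ^ i - 1)%N%:R <= - m) = (g + (#|F| ^ i)%:R * m <= m).
Proof.
move=> i0; rewrite ler_pdivrMr ?card_expn_sub1; last first.
  by rewrite subr_gt0 ltr1n -(expn0 #|F|) ltn_exp2l ?finNzRing_gt1.
by apply/idP/idP; nra.
Qed.

(** Uniqueness of the fixed point: the term of index [d] has slope at most [- m], and every term of
    positive index has slope at least [- m]. *)
Lemma graded_height_dominant (phi : drinfeld_module K) m d : (0 < d)%N ->
    dominant (fun i => (#|F| ^ i)%:R * m) (fun i => (phi 'X)`_i) m d ->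
  graded_height v phi = m.
Proof.
move=> d0 [gd ed le _]; apply: oppr_inj; apply/eqP; rewrite eq_le.
apply/andP; split.
  by rewrite (le_trans (graded_height_ge d0 gd)) // slope_ge // ed.
have [i /andP[i0 gi] ->] := graded_height_attained phi.
by rewrite slope_le // le.
Qed.

Lemma dominant_graded_height (phi : drinfeld_module K) :
    finite_place v ->
  exists2 d, (0 < d)%N &
    dominant (fun i => (#|F| ^ i)%:R * graded_height v phi)
      (fun i => (phi 'X)`_i) (graded_height v phi) d.
Proof.
move=> v_fin; set h := graded_height v phi.
have [i /andP[i0 gi] hi] := graded_height_attained phi.
have phiX0 : (phi 'X : {poly K}) != 0.
  by rewrite -size_poly_eq0 drinfeld_size.
have [m [d D]] := dominant_exists (fun i => (#|F| ^ i)%:R * h) phiX0.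
have le_i : (ord v (phi 'X)`_i)%:~R + (#|F| ^ i)%:R * h <= h.
  by rewrite -slope_ge // hi.
have mh : m = h.
  have [gd ed le _] := D; apply/eqP; rewrite eq_le (le_trans (le _ gi)) //=.
  (* Index 0 escapes the definition of the height; its coefficient T has weighted order ord(T) + h,
     at least h because [v] is finite. *)
  rewrite -ed; have [d0|d0] := posnP d; last first.
    by rewrite -slope_le // graded_height_ge.
  rewrite d0 drinfeld_coef0 expn0 mul1r lerDr ler0z.
  exact: finite_place_ordX.
(* The index [i] attaining the height has weighted order at most [h], so the last minimal index is
   at least [i], hence positive. *)
rewrite mh in D; exists d => //; case: D => _ _ _ lt.
rewrite (leq_trans i0) // leqNgt; apply/negP=> /lt/(_ gi).
by rewrite ltNge le_i.
Qed.

(** With [m] the value of [f] at the height of [phi], the product f phi_T has value [m] and last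
    index [d + e]. Measuring psi_T at [m] gives value [m'] and last index [e' + d] for psi_T f.
    Hence [m' = m] and [e' = e] is positive, so [m] is the height of [psi]. *)
Lemma dominant_isogeny (f : twisted K) (phi psi : drinfeld_module K) :
    finite_place v -> isogeny f phi psi ->
  exists d, dominant (fun i => (#|F| ^ i)%:R * graded_height v phi)
    (fun i => f`_i) (graded_height v psi) d.
Proof.
move=> v_fin [f0 f_isog]; have [e e0 Dphi] := dominant_graded_height phi v_fin.
have [m [d Df]] := dominant_exists
  (fun i => (#|F| ^ i)%:R * graded_height v phi) (p := f) f0.
have psiX0 : (psi 'X : {poly K}) != 0.
  by rewrite -size_poly_eq0 drinfeld_size.
have [m' [e' Dpsi]] := dominant_exists (fun i => (#|F| ^ i)%:R * m) psiX0.
have := dominant_tw_mul Dpsi Df; rewrite -f_isog => D1.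
have [mm de] := dominant_unique D1 (dominant_tw_mul Df Dphi).
rewrite mm in Dpsi; suff -> : graded_height v psi = m by exists d.
by apply: graded_height_dominant Dpsi; lia.
Qed.

End Valuation.

(** * Separability and lowest coefficients of additive polynomials *)

Section Kernels.
Variables (F : finFieldType) (K : fieldExtType {fraction {poly F}}).
Variables (Kbar : closedFieldType) (iota : {rmorphism K -> Kbar}).
Implicit Types f g : twisted K.

Lemma card_pchar : (#|F|%:R : K) = 0.
Proof.
have p_q : pdiv #|F| \in \pi(#|F|) by rewrite pi_pdiv finNzRing_gt1.
have := pnatPpi (pchar_pnat_cardX K 1); rewrite expn1 => /(_ _ p_q) pK.
by apply/eqP; rewrite -(dvdn_pcharf pK) pdiv_dvd.
Qed.

(** The exponents q^i with i > 0 vanish in K, so only the linear term contributes. *)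
Lemma deriv_tw_poly f : (tw_poly f)^`() = (f`_0)%:P.
Proof.
rewrite /tw_poly raddf_sum; have [sz|] := posnP (size f).
  by rewrite sz big_ord0 nth_default ?sz.
move=> sz; rewrite -(prednK sz) big_ord_recl /= derivZ derivXn.
rewrite expn0 mulr1n expr0 alg_polyC big1 ?addr0 // => i _.
rewrite derivZ derivXn -mulr_natl expnS natrM -polyC_natr card_pchar.
by rewrite !mul0r scaler0.
Qed.

Lemma tw_poly_separable f : tw_normalized f -> separable_poly (tw_poly f).
Proof.
by move=> f1; rewrite unlock deriv_tw_poly f1 coprimep1.
Qed.

Lemma coef1_tw_poly f : (tw_poly f)`_1 = f`_0.
Proof. by rewrite -(coef_tw_poly_card f 0). Qed.

Lemma coef0_tw_poly f : (tw_poly f)`_0 = 0.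
Proof.
apply/eqP/negP => /negP/coef_tw_poly_neq0[i /esym/eqP].
by rewrite expn_eq0 (gtn_eqF (ltnW (finNzRing_gt1 F))).
Qed.

(** Both factors are divisible by x, so their product starts in degree 2, even when q = 2; this
    gives access to Q(0). *)
Lemma coef2_tw_poly_mul f g : (tw_poly f * tw_poly g)`_2 = f`_0 * g`_0.
Proof.
rewrite coefM !big_ord_recl big_ord0 /= !coef0_tw_poly !coef1_tw_poly.
by rewrite mul0r mulr0 addr0 add0r addr0.
Qed.

Lemma coef_lt2_tw_poly_mul f g i :
  (i < 2)%N -> (tw_poly f * tw_poly g)`_i = 0.
Proof.
case: i => [|[|]] // _; rewrite coefM !big_ord_recl big_ord0 /=.
  by rewrite !coef0_tw_poly mul0r addr0.
by rewrite !coef0_tw_poly mul0r mulr0 !addr0.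
Qed.

End Kernels.

(** * Divisibility read off from roots in a closed field *)

Section ClosedFieldRoots.
Variables (K : fieldType) (L : closedFieldType) (iota : {rmorphism K -> L}).
Implicit Types p u : {poly K}.
Local Notation "p ^i" := (map_poly iota p) (at level 2, format "p ^i").

(** Over [L], [p] is up to a scalar a product of distinct linear factors, each dividing the image of
    [u]; divisibility descends along [iota]. *)
Lemma separable_roots_dvdp p u : separable_poly p ->
  (forall x, root p^i x -> root u^i x) -> p %| u.
Proof.
move=> sep_p sub_pu; rewrite -(dvdp_map iota).
have [s Ds] := closed_field_poly_normal p^i.
have lc0 : lead_coef p^i != 0.
  by rewrite lead_coef_eq0 map_poly_eq0 separable_poly_neq0.
have eq_p : p^i %= \prod_(z <- s) ('X - z%:P) by rewrite Ds eqp_scale.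
rewrite (eqp_dvdl _ eq_p); apply: uniq_roots_dvdp.
  by apply/allP=> x xs; rewrite sub_pu // Ds rootZ // root_prod_XsubC.
rewrite uniq_rootsE -separable_prod_XsubC -(eqp_separable eq_p).
by rewrite separable_map.
Qed.

(** Writing [pG = u * pc], it suffices that [u * pH] divide [ps], which follows from [u] and [pH]
    being coprime divisors of [ps]. *)
Lemma dvdp_mul_cap_sum pG pH pc ps :
    separable_poly pG -> separable_poly pH -> separable_poly pc ->
    (forall x, root pc^i x = root pG^i x && root pH^i x) ->
    (forall x, root pG^i x || root pH^i x -> root ps^i x) ->
  pG * pH %| ps * pc.
Proof.
move=> sepG sepH sepc capE sumE.
have [|u Du] := dvdpP _ _ (separable_roots_dvdp sepc (u := pG) _).
  by move=> x; rewrite capE => /andP[].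
have G_s : pG %| ps.
  by apply: separable_roots_dvdp => // x Gx; rewrite sumE ?Gx.
have H_s : pH %| ps.
  by apply: separable_roots_dvdp => // x Hx; rewrite sumE ?Hx ?orbT.
rewrite Du mulrAC dvdp_mul // Gauss_dvdp.
  by rewrite H_s andbT (dvdp_trans _ G_s) // Du dvdp_mulr.
(* A common root of [u] and [pH] is a root of [pG] and [pH], hence of [pc]; it would be a double
   root of the separable [pG]. *)
move: sepG; rewrite Du separable_mul => /and3P[_ _ co_u].
rewrite -(coprimep_map iota); apply: Pdiv.ClosedField.root_coprimep => x ux.
apply/negP=> Hx; move: co_u; rewrite -(coprimep_map iota) => /coprimep_root.
move/(_ _ ux)/negP; apply; have := capE x.
by rewrite Du rmorphM rootM ux /= !rootE Hx => ->.
Qed.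

End ClosedFieldRoots.

(** * The inequality of heights *)

Theorem theorem3 (F : finFieldType) (K : fieldExtType {fraction {poly F}})
    (Kbar : closedFieldType) (iota : {rmorphism K -> Kbar})
    (Kbar_alg : forall x : Kbar, algebraicOver iota x)
    (phi : drinfeld_module K) (v : place K) (v_fin : finite_place v)
    (G H : set Kbar) (hG : SG iota phi G) (hH : SG iota phi H)
    (phi_cap phi_sum phi_G phi_H : drinfeld_module K)
    (h_cap : is_quotient iota phi (G `&` H) phi_cap)
    (h_sum : is_quotient iota phi (set_sum G H) phi_sum)
    (h_G : is_quotient iota phi G phi_G)
    (h_H : is_quotient iota phi H phi_H) :
  graded_height v phi_cap + graded_height v phi_sum
    <= graded_height v phi_G + graded_height v phi_H.
Proof.
case: h_cap h_sum h_G h_H => fc [isc nc kc] [fs [iss ns ks]].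
move=> [fG [isG nG kG]] [fH [isH nH kH]].
have rootE (f : twisted K) S x : tw_ker iota f = S ->
    root (map_poly iota (tw_poly f)) x <-> S x by move=> <-.
have [Q DQ] : exists Q, tw_poly fs * tw_poly fc = Q * (tw_poly fG * tw_poly fH).
  apply/dvdpP/(@dvdp_mul_cap_sum _ _ iota); try exact: tw_poly_separable.
    move=> x; apply/idP/andP.
      by move=> /(rootE _ _ x kc)[/(rootE _ _ x kG) ? /(rootE _ _ x kH)].
    move=> [/(rootE _ _ x kG) Gx /(rootE _ _ x kH) Hx].
    exact/(rootE _ _ x kc).
  (* Each of G and H lies in G + H, by adding the zero of the other. *)
  move=> x xGH; apply/(rootE _ _ x ks).
  case/orP: xGH => [/(rootE _ _ x kG) Gx | /(rootE _ _ x kH) Hx].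
    by exists x => //; exists 0; [exact: SG_0 hH | rewrite addr0].
  by exists 0; [exact: SG_0 hG | exists x => //; rewrite add0r].
(* Both sides of [DQ] are compared in degree 2, where the two products of normalized polynomials
   have coefficient 1. *)
have Q0 : Q`_0 = 1.
  have := coef2_tw_poly_mul fs fc; rewrite DQ ns nc mulr1 coefM.
  rewrite !big_ord_recl big_ord0 /= coef2_tw_poly_mul nG nH !mulr1.
  by rewrite !coef_lt2_tw_poly_mul // !mulr0 !addr0.
have Qn0 : Q != 0.
  by apply: contra_eq_neq Q0 => ->; rewrite coef0 eq_sym oner_neq0.
pose h := graded_height v phi.
have dom f psi : isogeny f phi psi -> exists d,
    dominant v (fun i => i%:R * h) (fun i => (tw_poly f)`_i)
      (graded_height v psi) d.
  by move=> /(dominant_isogeny v_fin)[d /dominant_tw_poly]; exists (#|F| ^ d)%N.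
have [[dc Dc] [ds Ds] [dG DG] [dH DH]] :=
  And4 (dom _ _ isc) (dom _ _ iss) (dom _ _ isG) (dom _ _ isH).
have [m [d D]] := dominant_exists v (fun i => i%:R * h) Qn0.
have := dominant_poly_mul D (dominant_poly_mul DG DH); rewrite -DQ.
move=> /dominant_unique/(_ (dominant_poly_mul Ds Dc))[Dm _].
(* The constant term 1 of [Q] has weighted order 0, which bounds the minimum [m]. *)
have : m <= 0.
  have [_ _ /(_ 0) + _] := D.
  by rewrite Q0 ord1 mul0r addr0; apply; exact: oner_neq0.
by rewrite addrC -Dm gerDr.
Qed.
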